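(* Fix $\varepsilon>0$ and let $\boldsymbol{u}=\boldsymbol{v}=(1/2,1/2)$. Let $A$ be any nonnegative $2\times2$ matrix that is $(\boldsymbol{u},\boldsymbol{v})$-scalable, and let $A^{(0)},A^{(1)},\dots$ be the SK iterates with input $(A,(\boldsymbol{u},\boldsymbol{v}))$. Then there exists $K=O(1/\varepsilon)$ such that $\|\boldsymbol{r}(A^{(K)})-\boldsymbol{u}\|_1+\|\boldsymbol{c}(A^{(K)})-\boldsymbol{v}\|_1\le\varepsilon$.
   Context: SK on input $(A,(\boldsymbol{u},\boldsymbol{v}))$: $A^{(0)}_{ij}=u_iA_{ij}/r_i(A)$; odd $k$: $A^{(k)}_{ij}=v_jA^{(k-1)}_{ij}/c_j(A^{(k-1)})$; even $k\ge2$: $A^{(k)}_{ij}=u_iA^{(k-1)}_{ij}/r_i(A^{(k-1)})$ ($r_i,c_j$ row/column sums, $\boldsymbol{r},\boldsymbol{c}$ their vectors). $A$ is $(\boldsymbol{u},\boldsymbol{v})$-scalable if there exist positive diagonal $X,Y$ with $XAY$ having row sums $\boldsymbol{u}$ and column sums $\boldsymbol{v}$. $O$ hides an absolute constant. *)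

(* Defs.v *)
From HB Require Import structures.
From mathcomp Require Import all_boot all_order all_algebra.
From mathcomp Require Import reals.

Set Implicit Arguments.
Unset Strict Implicit.
Unset Printing Implicit Defensive.

Import Order.TTheory GRing.Theory Num.Theory.
Local Open Scope ring_scope.

Section SinkhornKnopp.
Variables (R : realType) (m n : nat).
Implicit Types (A : 'M[R]_(m, n)) (u : 'rV[R]_m) (v : 'rV[R]_n).

Definition row_sums A : 'rV[R]_m := \row_i \sum_j A i j.
Definition col_sums A : 'rV[R]_n := \row_j \sum_i A i j.

Definition row_normalize u A : 'M[R]_(m, n) :=
  \matrix_(i, j) (u 0 i * A i j / row_sums A 0 i).
Definition col_normalize v A : 'M[R]_(m, n) :=
  \matrix_(i, j) (v 0 j * A i j / col_sums A 0 j).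

(* The iterate of index 0 is already row-normalized; odd steps normalize the
   columns, and even steps the rows. *)
Fixpoint SK A u v (k : nat) : 'M[R]_(m, n) :=
  match k with
  | 0 => row_normalize u A
  | k'.+1 => if odd k then col_normalize v (SK A u v k')
             else row_normalize u (SK A u v k')
  end.

Definition uv_scalable u v A : Prop :=
  exists (x : 'rV[R]_m) (y : 'rV[R]_n),
    [/\ forall i, 0 < x 0 i, forall j, 0 < y 0 j,
        row_sums (diag_mx x *m A *m diag_mx y) = u
      & col_sums (diag_mx x *m A *m diag_mx y) = v].

End SinkhornKnopp.

(* The library's norm `|x| on matrices is the sup norm. *)
Definition l1norm (R : realType) (n : nat) (x : 'rV[R]_n) : R :=
  \sum_i `|x 0 i|.

(* Main.v *)
(** A row-normalized nonnegative matrix is [[a, 1-a], [b, 1-b]] / 2 with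
    [a, b] in [0, 1], and its error is [e = |1 - a - b|]. Normalizing the columns
    turns the error into [e' = |a - b| e / (1 - e^2)], and [|a - b| <= 1 - e]
    gives [e' <= e / (1 + e)]. As the initial error is at most 1, the error after
    k steps is at most 1 / (k + 1). Scalability only ensures that no row or column
    vanishes. *)
Require Import Defs.
From HB Require Import structures.
From mathcomp Require Import all_boot all_order all_algebra.
From mathcomp Require Import reals.
From mathcomp Require Import ring lra.

Import Order.TTheory GRing.Theory Num.Theory.
Local Open Scope ring_scope.

(** A sum of nonnegative terms vanishes only if every term does, and positive weights do not change
    which terms are zero. *)
Lemma weighted_sumr_gt0 (R : realType) (I : finType) (w F : I -> R) :
  (forall i, 0 < w i) -> (forall i, 0 <= F i) ->
  (0 < \sum_i w i * F i) = (0 < \sum_i F i).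
Proof.
move=> w_gt0 F_ge0.
have wF_ge0 i : 0 <= w i * F i by rewrite mulr_ge0 // ltW.
rewrite !lt_neqAle !sumr_ge0 // !andbT ![0 == _]eq_sym !psumr_eq0 //.
by congr (~~ _); apply: eq_all => i /=; rewrite mulf_eq0 gt_eqF.
Qed.

Section Normalization.
Set Implicit Arguments.
Unset Strict Implicit.
Variable R : realType.

(** Invariant of the iteration: positive sums keep every normalization a genuine division, since
    [x / 0] is [0] here. *)
Definition nonneg_support m n (A : 'M[R]_(m, n)) : Prop :=
  [/\ forall i j, 0 <= A i j, forall i, 0 < row_sums A 0 i
    & forall j, 0 < col_sums A 0 j].

Definition sk_error m n (u : 'rV[R]_m) (v : 'rV[R]_n) (A : 'M[R]_(m, n)) : R :=
  l1norm (row_sums A - u) + l1norm (col_sums A - v).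

Lemma sumr_ord2 (F : 'I_2 -> R) : \sum_i F i = F 0 + F 1.
Proof. by rewrite !big_ord_recl big_ord0 addr0; congr (F _ + F _); apply/val_inj. Qed.

Lemma row_sums_tr m n (A : 'M[R]_(m, n)) : row_sums A^T = col_sums A.
Proof. by apply/rowP => j; rewrite !mxE; apply: eq_bigr => i _; rewrite mxE. Qed.

Lemma col_sums_tr m n (A : 'M[R]_(m, n)) : col_sums A^T = row_sums A.
Proof. by rewrite -row_sums_tr trmxK. Qed.

Lemma col_normalize_tr m n (v : 'rV[R]_n) (A : 'M[R]_(m, n)) :
  (col_normalize v A)^T = row_normalize v A^T.
Proof. by apply/matrixP => i j; rewrite /row_normalize row_sums_tr !mxE. Qed.

Lemma nonneg_support_tr m n (A : 'M[R]_(m, n)) :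
  nonneg_support A -> nonneg_support A^T.
Proof.
by case=> A0 r0 c0; split; rewrite ?row_sums_tr ?col_sums_tr // => i j; rewrite mxE.
Qed.

Lemma sk_error_tr m n (u : 'rV[R]_m) (v : 'rV[R]_n) (A : 'M[R]_(m, n)) :
  sk_error v u A^T = sk_error u v A.
Proof. by rewrite /sk_error row_sums_tr col_sums_tr addrC. Qed.

Lemma l1norm0 n : l1norm (0 : 'rV[R]_n) = 0.
Proof. by rewrite /l1norm big1 // => i _; rewrite mxE normr0. Qed.

Lemma sk_error_ge0 m n (u : 'rV[R]_m) (v : 'rV[R]_n) (A : 'M[R]_(m, n)) :
  0 <= sk_error u v A.
Proof. by rewrite addr_ge0 // sumr_ge0. Qed.

Lemma row_sums_normalize m n (u : 'rV[R]_m) (A : 'M[R]_(m, n)) :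
  nonneg_support A -> row_sums (row_normalize u A) = u.
Proof.
case=> _ r0 _; apply/rowP => i; rewrite mxE.
under eq_bigr => j _ do rewrite mxE.
by rewrite -mulr_suml -mulr_sumr; have := r0 i; rewrite !mxE => /gt_eqF/negbT/mulfK ->.
Qed.

Lemma nonneg_support_row_normalize m n (u : 'rV[R]_m) (A : 'M[R]_(m, n)) :
  (forall i, 0 < u 0 i) -> nonneg_support A -> nonneg_support (row_normalize u A).
Proof.
move=> u0 hA; have [A0 r0 c0] := hA; split=> [i j|i|j].
- by rewrite mxE divr_ge0 ?mulr_ge0 // ltW.
- by rewrite row_sums_normalize.
(* Column [j] of the normalized matrix is column [j] of [A] with positive weights
   [u 0 i / row_sums A 0 i]. *)
- rewrite mxE; under eq_bigr => i _ do rewrite mxE mulrAC.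
  rewrite weighted_sumr_gt0 // => [|i]; last by rewrite divr_gt0.
  by have := c0 j; rewrite mxE.
Qed.

Lemma uv_scalable_nonneg_support m n (u : 'rV[R]_m) (v : 'rV[R]_n)
    (A : 'M[R]_(m, n)) :
  (forall i, 0 < u 0 i) -> (forall j, 0 < v 0 j) -> (forall i j, 0 <= A i j) ->
  uv_scalable u v A -> nonneg_support A.
Proof.
move=> u0 v0 A0 [x [y [x0 y0 ru cv]]].
have E i j : (diag_mx x *m A *m diag_mx y) i j = x 0 i * y 0 j * A i j.
  by rewrite mul_mx_diag mul_diag_mx !mxE mulrAC.
split=> // [i|j].
- have := u0 i; rewrite -ru !mxE; under eq_bigr => j _ do rewrite E.
  by rewrite weighted_sumr_gt0 // => j; rewrite mulr_gt0.
- have := v0 j; rewrite -cv !mxE; under eq_bigr => i _ do rewrite E.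
  by rewrite weighted_sumr_gt0 // => i; rewrite mulr_gt0.
Qed.

Notation half := (const_mx (1 / 2) : 'rV[R]_2).

(** The row part of the error is zero. The two column sums add up to 1, so their deviations from 1/2
    are opposite and the error is twice the first one in absolute value. *)
Lemma sk_error_row_normalized (A : 'M[R]_2) : row_sums A = half ->
  A 0 1 = 1 / 2 - A 0 0 /\ A 1 1 = 1 / 2 - A 1 0 /\
  sk_error half half A = `|1 - 2 * (A 0 0 + A 1 0)|.
Proof.
move=> rA.
have := congr1 (fun r : 'rV_2 => r 0 0) rA; have := congr1 (fun r : 'rV_2 => r 0 1) rA.
rewrite !mxE !sumr_ord2.
move=> r1 r0.
have e0 : A 0 1 = 1 / 2 - A 0 0 by lra.
have e1 : A 1 1 = 1 / 2 - A 1 0 by lra.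
split=> //; split=> //.
rewrite /sk_error rA subrr l1norm0 add0r /l1norm !sumr_ord2 !mxE.
rewrite !sumr_ord2.
rewrite e0 e1.
have -> : 1 / 2 - A 0 0 + (1 / 2 - A 1 0) - 1 / 2 = - (A 0 0 + A 1 0 - 1 / 2) by lra.
have -> : 1 - 2 * (A 0 0 + A 1 0) = - (2 * (A 0 0 + A 1 0 - 1 / 2)) by lra.
by rewrite !normrN normrM ger0_norm //; lra.
Qed.

Lemma sk_error_le1 (A : 'M[R]_2) :
  (forall i j, 0 <= A i j) -> row_sums A = half -> sk_error half half A <= 1.
Proof.
move=> A0 /sk_error_row_normalized[e0 [e1 ->]].
have := (A0 0 0, A0 1 0, A0 0 1, A0 1 1); rewrite e0 e1 => -[[[? ?] ?] ?].
by rewrite ler_norml; lra.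
Qed.

Lemma abs_contraction (a b : R) :
  0 <= a <= 1 -> 0 <= b <= 1 -> 0 < a + b < 2 ->
  `|(a - b) * (1 - (a + b)) / ((a + b) * (2 - (a + b)))|
    <= `|1 - (a + b)| / (1 + `|1 - (a + b)|).
Proof.
move=> ha hb hs; set d := 1 - (a + b).
have d1 : `|d| < 1 by rewrite ltr_norml /d; lra.
have d0 := normr_ge0 d.
have -> : (a + b) * (2 - (a + b)) = (1 - `|d|) * (1 + `|d|).
  have : `|d| ^+ 2 = d ^+ 2 by rewrite real_normK ?num_real.
  by rewrite /d; lra.
(* Nonnegativity of [a], [b] bounds [|a - b|] by [a + b = 1 - d], and nonnegativity of [1 - a],
   [1 - b] bounds it by [2 - (a + b) = 1 + d]; the smaller bound is [1 - |d|]. *)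
have hab : `|a - b| <= 1 - `|d|.
  by rewrite /d; case: (ger0P (1 - (a + b))) => ?; rewrite ler_norml; lra.
rewrite !normrM normfV [`|(1 - _) * _|]ger0_norm; last by rewrite mulr_ge0; lra.
rewrite ler_pdivrMr; last by rewrite mulr_gt0; lra.
apply: le_trans (_ : (1 - `|d|) * `|d| <= _); first by rewrite ler_wpM2r.
have hd : 1 + `|d| != 0 by apply: lt0r_neq0; lra.
by rewrite [(1 - _) * (1 + _)]mulrC mulrA divfK // mulrC.
Qed.

Lemma sk_error_col_normalize (A : 'M[R]_2) :
  nonneg_support A -> row_sums A = half ->
  sk_error half half (col_normalize half A)
    <= sk_error half half A / (1 + sk_error half half A).
Proof.
move=> hA rA; have [A0 _ c0] := hA.
(* Transposing makes the new matrix row-normalized, so one error formula serves both before and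
   after the step. *)
set B := (col_normalize half A)^T.
have BE : B = row_normalize half A^T by rewrite /B col_normalize_tr.
have rB : row_sums B = half by rewrite BE row_sums_normalize //; apply: nonneg_support_tr.
rewrite -sk_error_tr -/B.
have [_ [_ ->]] := sk_error_row_normalized rB.
have [e0 [e1 ->]] := sk_error_row_normalized rA.
have := (c0 0, c0 1); rewrite !mxE !sumr_ord2.
rewrite e0 e1 => -[s0 s2].
have := (A0 0 0, A0 1 0, A0 0 1, A0 1 1); rewrite e0 e1 => -[[[a0 b0] a1] b1].
set a := A 0 0 in a0 a1 s0 s2 *; set b := A 1 0 in b0 b1 s0 s2 *.
(* Rows sum to 1/2, so doubling brings the entries into [0, 1]. Taking [b] before [a] makes the
   signed expressions agree, not only their absolute values. *)
have := @abs_contraction (2 * b) (2 * a) _ _ _.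
have -> : (2 * b - 2 * a) * (1 - (2 * b + 2 * a))
    / ((2 * b + 2 * a) * (2 - (2 * b + 2 * a)))
    = 1 - 2 * (1 / 2 * a / (a + b) + 1 / 2 * (1 / 2 - a) / (1 / 2 - a + (1 / 2 - b))).
  field; apply/and3P; split; apply: lt0r_neq0; lra.
have -> : 2 * b + 2 * a = 2 * (a + b) by ring.
by apply; apply/andP; split; lra.
Qed.

Lemma sk_error_row_normalize (A : 'M[R]_2) :
  nonneg_support A -> col_sums A = half ->
  sk_error half half (row_normalize half A)
    <= sk_error half half A / (1 + sk_error half half A).
Proof.
move=> /nonneg_support_tr hA; rewrite -row_sums_tr => /(sk_error_col_normalize hA).
by rewrite sk_error_tr -sk_error_tr col_normalize_tr trmxK.
Qed.

Lemma SK_error_le (A : 'M[R]_2) (k : nat) : nonneg_support A ->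
  sk_error half half (SK A half half k) <= k.+1%:R^-1.
Proof.
move=> hA; have half_gt0 i : 0 < half 0 i by rewrite mxE; lra.
(* The induction also records which family of sums is exact: it alternates with the parity of [k]
   and decides which contraction lemma applies. *)
suff [] : [/\ nonneg_support (SK A half half k),
    (if odd k then col_sums (SK A half half k) else row_sums (SK A half half k)) = half
    & sk_error half half (SK A half half k) <= k.+1%:R^-1] by [].
elim: k => [|k [hS nS eS]].
  have h0 := nonneg_support_row_normalize half_gt0 hA.
  have r0 := row_sums_normalize half hA.
  by split=> //=; rewrite invr1; case: h0 => *; apply: sk_error_le1.
(* Writing [e] for the current error, clearing denominators turns both [e <= 1/(k+1)] and
   [e/(1+e) <= 1/(k+2)] into [(k+1) e <= 1]. *)
have step (x : R) : x <= sk_error half half (SK A half half k)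
      / (1 + sk_error half half (SK A half half k)) -> x <= k.+2%:R^-1.
  move=> /le_trans; apply; move: (sk_error_ge0 half half (SK A half half k)) eS.
  move: (sk_error _ _ _) => e e0.
  have k0 : 0 < k.+1%:R :> R by rewrite ltr0n.
  have -> : k.+2%:R = k.+1%:R + 1 :> R by rewrite -addn1 natrD.
  rewrite -[k.+1%:R^-1]mul1r ler_pdivlMr // => hk.
  by rewrite ler_pdivrMr ?[_^-1 * _]mulrC ?ler_pdivlMr; lra.
rewrite /=; move: nS; case: (odd k) => nS /=.
- split; [exact: nonneg_support_row_normalize|exact: row_sums_normalize|].
  exact/step/sk_error_row_normalize.
- split.
  + rewrite -[col_normalize _ _]trmxK col_normalize_tr.
    by apply/nonneg_support_tr/nonneg_support_row_normalize/nonneg_support_tr.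
  + by rewrite -row_sums_tr col_normalize_tr row_sums_normalize //; apply: nonneg_support_tr.
  + exact/step/sk_error_col_normalize.
Qed.

End Normalization.

Theorem theorem7p4 (R : realType) :
  exists C : R, 0 < C /\
    forall (eps : R) (u v : 'rV[R]_2) (A : 'M[R]_2),
      0 < eps ->
      u = const_mx (1 / 2) -> v = const_mx (1 / 2) ->
      (forall i j, 0 <= A i j) ->
      uv_scalable u v A ->
      exists K : nat,
        K%:R <= C * (1 / eps) /\
        l1norm (row_sums (SK A u v K) - u)
          + l1norm (col_sums (SK A u v K) - v) <= eps.
Proof.
exists 1; split=> // eps u v A eps0 -> -> A0 sA.
have half_gt0 i : 0 < (const_mx (1 / 2) : 'rV[R]_2) 0 i by rewrite mxE; lra.
have hA := uv_scalable_nonneg_support half_gt0 half_gt0 A0 sA.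
have ieps0 : 0 <= eps^-1 by rewrite invr_ge0 ltW.
have /andP[Kle ltK] := truncn_itv ieps0.
(* The integer part [K] of [1/eps] satisfies [K <= 1/eps], so the constant 1 suffices, and
   [1/eps < K + 1], so the error bound [1/(K+1)] is below [eps]. *)
exists (Num.truncn eps^-1); split; first by rewrite !mul1r.
apply: le_trans (SK_error_le _ hA) _.
by rewrite -[leRHS]invrK lef_pV2 ?posrE ?invr_gt0 // ltW.
Qed.
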